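(* Let $T$ be a tree on $n$ vertices with diameter $d$. Then $m_{T}[0,1)=(d+1)/3$ if and only if $T\in \Gamma(n,d)$.
   Context: For a graph $G$, the Laplacian matrix is $L(G)=D(G)-A(G)$ (degree diagonal matrix minus adjacency matrix), and $m_G[0,1)$ denotes the number of eigenvalues of $L(G)$, counted with multiplicity, lying in $[0,1)$. For $d\equiv 2 \pmod 3$, let $P_{d+1}=v_1v_2\cdots v_{d+1}$ be a path on $d+1$ vertices; for nonnegative integers $n_1,\dots,n_{(d+1)/3}$, let $H_d(n_1,\dots,n_{(d+1)/3})$ be the tree obtained from $P_{d+1}$ by attaching, for each $1\le i\le (d+1)/3$, exactly $n_i$ new pendant vertices to the vertex $v_{3i-1}$. Define $\Gamma(n,d)$ as the set of all trees $H_d(n_1,\dots,n_{(d+1)/3})$ with $d\equiv 2\pmod 3$, $n_i\ge 0$ and $\sum_{i=1}^{(d+1)/3} n_i=n-d-1$ (so $\Gamma(n,d)$ is empty if $d\not\equiv 2\pmod 3$). *)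

(* Defs.v *)
From mathcomp Require Import all_boot all_order all_algebra.
From mathcomp Require Import polyrcf reals.

Set Implicit Arguments.
Unset Strict Implicit.
Unset Printing Implicit Defensive.

Import Order.TTheory GRing.Theory Num.Theory.

Record sgraph := SGraph {
  vertex :> finType;
  adj : rel vertex;
  adj_sym : symmetric adj;
  adj_irr : irreflexive adj }.

Arguments adj {s}.

Definition isomorphic (G H : sgraph) : Prop :=
  exists2 f : G -> H, bijective f & {mono f : x y / adj x y}.

(* Sizes up to 2 are allowed because [ucycle] also holds of the empty sequence
   and of [:: x; y] for adjacent x and y. *)
Definition acyclic (G : sgraph) : Prop :=
  forall c : seq G, ucycle adj c -> size c <= 2.

Definition connected (G : sgraph) : Prop :=
  0 < #|G| /\ forall x y : G, connect adj x y.

Definition is_tree (G : sgraph) : Prop := connected G /\ acyclic G.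

Definition has_walk (G : sgraph) (x y : G) (k : nat) : bool :=
  [exists p : k.-tuple G, path adj x p && (last x p == y)].

(* Least length of a walk from x to y; in a connected graph it is less than
   #|G|. The junk value for unreachable pairs is #|G|. *)
Definition dist (G : sgraph) (x y : G) : nat :=
  find (has_walk x y) (iota 0 #|G|).

Definition diameter (G : sgraph) : nat :=
  \max_(x : G) \max_(y : G) dist x y.

Definition degree (G : sgraph) (x : G) : nat := #|[pred y | adj x y]|.

Section Laplacian.
Local Open Scope ring_scope.
Variables (R : realType) (G : sgraph).

Definition adjacency_mx : 'M[R]_#|G| :=
  \matrix_(i, j) (adj (enum_val i) (enum_val j))%:R.

Definition degree_mx : 'M[R]_#|G| :=
  diag_mx (\row_i (degree (enum_val i))%:R).

Definition laplacian : 'M[R]_#|G| := degree_mx - adjacency_mx.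

(* [rootsR] lists the distinct real roots of a nonzero polynomial, and
   [mup x p] is the multiplicity of x as a root of p. *)
Definition laplacian_eig_count (I : interval R) : nat :=
  (\sum_(x <- rootsR (char_poly laplacian) | x \in I)
      mup x (char_poly laplacian))%N.

End Laplacian.

Section Hgraph.
Variables (d : nat) (ns : 'I_((d + 1) %/ 3) -> nat).

(* [inl a] is the path vertex v_(a+1); [inr (Tagged _ j)], with tag i, is the
   j-th pendant vertex attached to v_(3(i+1)-1), there being [ns i] of them. *)
Definition Hvertex : finType :=
  ('I_(d + 1) + {i : 'I_((d + 1) %/ 3) & 'I_(ns i)})%type.

Definition Hadj : rel Hvertex := fun x y =>
  match x, y with
  | inl a, inl b => (b == a.+1 :> nat) || (a == b.+1 :> nat)
  | inl a, inr u | inr u, inl a => a.+1 == 3 * (tag u).+1 - 1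
  | inr _, inr _ => false
  end.

Lemma Hadj_sym : symmetric Hadj.
Proof. by move=> [a|u] [b|w] //=; rewrite orbC. Qed.

Lemma Hadj_irr : irreflexive Hadj.
Proof. by move=> [a|u] //=; rewrite ltn_eqF. Qed.

Definition Hgraph : sgraph := SGraph Hadj_sym Hadj_irr.

End Hgraph.

(* Membership in Gamma(n, d), graphs being identified up to isomorphism. The
   condition on the sum is sum n_i = n - d - 1 without truncated subtraction. *)
Definition Gamma (n d : nat) (G : sgraph) : Prop :=
  d %% 3 = 2 /\
  exists ns : 'I_((d + 1) %/ 3) -> nat,
    \sum_(i < (d + 1) %/ 3) ns i + d + 1 = n /\ isomorphic G (Hgraph ns).

(* Main.v *)
Require Import Defs.
From HB Require Import structures.
From mathcomp Require Import all_boot all_order all_algebra.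
From mathcomp Require Import complex polyrcf reals.
From mathcomp Require Import ring lra zify.

Set Implicit Arguments.
Unset Strict Implicit.
Unset Printing Implicit Defensive.

Import Order.TTheory GRing.Theory Num.Theory.

(* By Sylvester's law of inertia, m_T[0,1) is the largest dimension of a space
   of vertex functions f on which q(f) = sum_(uw edge) (f u - f w)^2 - sum_u f(u)^2
   is negative definite.

   If T is in Gamma(n, d), the k = (d+1)/3 vertices v_(3i-1) dominate T, and q
   is nonnegative on the functions vanishing on a dominating set, so
   m_T[0,1) <= k.

   Conversely take a diametral path with 3k vertices and reals t_0, ..., t_k.
   Give the i-th block of three consecutive path vertices the values
   t_(i-1), b_i, t_i with b_i = (t_(i-1) + t_i) / 2, and extend this function
   to be constant along the branches leaving the path. Then
   q = - 3 sum b_i^2 - sum_(u off the path) f(u)^2. Setting t_k = 0 makes q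
   negative definite in dimension k. The remaining direction, t_i = (-1)^i,
   vanishes exactly at the middle vertices v_(3i-1); hence a branch leaving the
   path elsewhere gives dimension k + 1. If a branch with at least two vertices
   leaves from v_(3i-1), a value y on the whole branch, independent of t,
   changes q by at most (y - b_i)^2 - 2 y^2 = 2 b_i^2 - (y + b_i)^2, and q is
   again negative definite in dimension k + 1. So m_T[0,1) = k forces every
   vertex off the path to be a pendant neighbour of some v_(3i-1). *)

(** * Inertia of symmetric matrices *)

Section LinearAlgebra.
Local Open Scope ring_scope.

Lemma char_poly_conj (F : fieldType) n (P M : 'M[F]_n) :
  P \in unitmx -> char_poly (invmx P *m M *m P) = char_poly M.
Proof.
move=> Pu; rewrite /char_poly.
have -> : char_poly_mx (invmx P *m M *m P) =
    map_mx polyC (invmx P) *m char_poly_mx M *m map_mx polyC P.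
  rewrite /char_poly_mx mulmxBr mulmxBl !map_mxM; congr (_ - _).
  by rewrite mul_mx_scalar -scalemxAl -map_mxM mulVmx // map_mx1 scalemx1.
by rewrite !det_mulmx mulrAC -det_mulmx -map_mxM mulVmx // map_mx1 det1 mul1r.
Qed.

Lemma exists_left_kernel (F : fieldType) m k (N : 'M[F]_(m, k)) :
  (k < m)%N -> exists2 v : 'rV[F]_m, v != 0 & v *m N = 0.
Proof.
move=> km; have : kermx N != 0.
  rewrite -mxrank_eq0 mxrank_ker subn_eq0 -ltnNge.
  exact: leq_ltn_trans (rank_leq_col N) km.
by case/rowV0Pn=> v /sub_kermxP vN v0; exists v.
Qed.

End LinearAlgebra.

Section Inertia.
Local Open Scope ring_scope.
Variables (R : rcfType) (n : nat) (A : 'M[R]_n).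
Hypothesis A_sym : A^T = A.
Local Open Scope sesquilinear_scope.

Local Notation C := (R[i])%type.
Local Notation toC := (real_complex R).
Local Notation cmx := (map_mx toC).

Definition qform (M : 'M[R]_n) (x : 'rV[R]_n) : R := (x *m M *m x^T) 0 0.

Definition eig_count_lt (a : R) : nat :=
  (\sum_(x <- rootsR (char_poly A) | (x < a)%R) mup x (char_poly A))%N.

Lemma conjC_Re_Im (z : C) : z^* = toC (complex.Re z) - 'i%C * toC (complex.Im z).
Proof.
case: z => x y; apply/eqP; rewrite eq_complex /=.
by apply/andP; split; apply/eqP; ring.
Qed.

(** The spectral theorem is applied over [R[i]], whereas the forms to be tested are real. The cross
    terms between real and imaginary parts cancel because [M] is symmetric. *)
Lemma hermitian_form_Re_Im (M : 'M[R]_n) (z : 'rV[C]_n) : M^T = M ->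
  (z *m cmx M *m z^t*) 0 0 =
  toC (qform M (map_mx (@complex.Re R) z) + qform M (map_mx (@complex.Im R) z)).
Proof.
move=> Msym; set x := map_mx _ z; set y := map_mx (@complex.Im R) z.
have zE : z = cmx x + 'i%C *: cmx y.
  by apply/rowP=> j; rewrite !mxE -complexE.
have zcE : z^t* = cmx x^T - 'i%C *: cmx y^T.
  by apply/colP=> j; rewrite !mxE conjC_Re_Im.
have yMx : y *m M *m x^T = x *m M *m y^T.
  apply/matrixP=> i j; rewrite !ord1.
  by rewrite -[y *m M *m _]trmxK mxE !trmx_mul trmxK Msym mulmxA.
rewrite {1}zE zcE mulmxDl mulmxBr !mulmxDl -!scalemxAl -!scalemxAr -!map_mxM /= yMx.
rewrite scalerA -expr2 sqr_i scaleN1r.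
rewrite opprD opprK addrA addrK /qform rmorphD /=.
by rewrite mxE; congr (_ + _); rewrite [LHS]mxE.
Qed.

(** Over [R[i]] a real symmetric matrix is Hermitian, so its eigenvalues are real and only [P] has
    complex entries. *)
Lemma symmetric_spectral : exists (P : 'M[C]_n) (D : 'rV[R]_n),
  [/\ P *m P^t* = 1%:M, P^t* *m P = 1%:M & cmx A = P^t* *m cmx (diag_mx D) *m P].
Proof.
have Ah : cmx A \is hermsymmx.
  apply/is_hermitianmxP; rewrite expr0 scale1r.
  by apply/matrixP=> i j; rewrite !mxE conjC_Re_Im /= mulr0 subr0 -[in LHS]A_sym mxE.
have Pu := spectral_unitarymx (cmx A).
have /orthomx_spectralP := hermitian_normalmx Ah; rewrite invmx_unitary // => AE.
have Dr := hermitian_spectral_diag_real Ah.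
exists (spectralmx (cmx A)), (map_mx (@complex.Re R) (spectral_diag (cmx A))); split.
- exact/unitarymxP.
- by rewrite -invmx_unitary // mulVmx // unitarymx_unit.
rewrite [LHS]AE map_diag_mx; do 2 congr (_ *m _); congr diag_mx.
apply/rowP=> j; rewrite [RHS]mxE [in RHS]mxE.
by rewrite [RHS](RRe_real (mxOverP Dr _ _)).
Qed.

Lemma eig_count_lt_diag (D : 'rV[R]_n) a :
  char_poly A = \prod_(j < n) ('X - (D 0 j)%:P) ->
  eig_count_lt a = #|[set j | D 0 j < a]|.
Proof.
move=> cA; rewrite /eig_count_lt.
have cE : char_poly A = \prod_(y <- [seq D 0 j | j <- enum 'I_n]) ('X - y%:P).
  by rewrite cA big_map big_enum.
have p0 : char_poly A != 0 by rewrite monic_neq0 ?char_poly_monic.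
(* Multiplicities become sums of indicators over the indices [j]; after the exchange each [j] is
   counted once, at the root [D 0 j]. *)
under eq_bigr => x _ do rewrite {1}cE mu_prod_XsubC count_map -sum1_count
  big_mkcond big_enum /=.
rewrite exchange_big /= -sum1_card [RHS]big_mkcond /=; apply: eq_bigr => j _.
have Dj : D 0 j \in rootsR (char_poly A).
  rewrite -roots_on_rootsR // cE root_prod_XsubC; apply/mapP; exists j => //.
  by rewrite mem_enum.
rewrite inE -big_mkcondr sum1_count /=; case: ltP => Da.
  rewrite (@eq_count _ _ (pred1 (D 0 j))) ?count_uniq_mem ?uniq_roots ?Dj // => x /=.
  by rewrite eq_sym; case: eqP => [->|]; rewrite ?Da ?andbF.
rewrite (@eq_count _ _ pred0) ?count_pred0 // => x /=.
by rewrite eq_sym; case: eqP => [->|]; rewrite ?andbF // ltNge Da.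
Qed.

Lemma hermitian_form_diag (P : 'M[C]_n) (D : 'rV[R]_n) a (z : 'rV[C]_n) :
  P^t* *m P = 1%:M -> cmx A = P^t* *m cmx (diag_mx D) *m P ->
  (z *m cmx (A - a%:M) *m z^t*) 0 0 =
  \sum_j toC (D 0 j - a) * `|(z *m P^t*) 0 j| ^+ 2.
Proof.
move=> PP AE; have -> : cmx (A - a%:M) = P^t* *m cmx (diag_mx (D - const_mx a)) *m P.
  rewrite linearB /= diag_const_mx !map_mxB AE mulmxBr mulmxBl; congr (_ - _).
  by rewrite map_scalar_mx mul_mx_scalar -scalemxAl PP scalemx1.
have -> : z *m (P^t* *m cmx (diag_mx (D - const_mx a)) *m P) *m z^t* =
    z *m P^t* *m cmx (diag_mx (D - const_mx a)) *m (z *m P^t*)^t*.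
  by rewrite trmx_mul map_mxM trmxCK !mulmxA.
rewrite map_diag_mx mul_mx_diag mxE; apply: eq_bigr => j _.
by rewrite !mxE normCK mulrCA mulrA.
Qed.

Lemma eig_count_lt_spectral a : exists (P : 'M[C]_n) (D : 'rV[R]_n),
  [/\ P *m P^t* = 1%:M, P^t* *m P = 1%:M,
      cmx A = P^t* *m cmx (diag_mx D) *m P
    & eig_count_lt a = #|[set j | D 0 j < a]|].
Proof.
have [P [D [PP PP' AE]]] := symmetric_spectral; exists P, D; split=> //.
apply: eig_count_lt_diag; apply: (map_poly_inj toC); rewrite map_char_poly AE.
have Pu : P \is unitarymx by apply/unitarymxP.
rewrite -invmx_unitary // char_poly_conj ?unitarymx_unit // map_diag_mx.
rewrite char_poly_trig ?diag_mx_is_trig // rmorph_prod; apply: eq_bigr => j _.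
by rewrite rmorphB /= map_polyX map_polyC !mxE eqxx.
Qed.

Lemma trmx_sub_scalar a : (A - a%:M)^T = A - a%:M.
Proof. by rewrite linearB /= A_sym tr_scalar_mx. Qed.

(** Were [m] larger than the number of eigenvalues below [a], some nonzero combination of the rows
    of [B] would be orthogonal to all their eigenvectors, and the form is nonnegative on such
    vectors. *)
Lemma negative_subspace_eig_count m (B : 'M[R]_(m, n)) a :
  (forall v, v != 0 -> qform (A - a%:M) (v *m B) < 0) -> (m <= eig_count_lt a)%N.
Proof.
move=> negB; have [P [D [_ PP AE ->]]] := eig_count_lt_spectral a.
set J := [set j | _]; rewrite leqNgt; apply/negP => Jm.
pose N : 'M[C]_(m, #|J|) := \matrix_(i, j) (cmx B *m P^t*) i (enum_val j).
have [v v0 vN] := exists_left_kernel N Jm.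
have := hermitian_form_diag a (v *m cmx B) PP AE.
rewrite hermitian_form_Re_Im ?trmx_sub_scalar // => hE.
have : 0 <= toC (qform (A - a%:M) (map_mx (@complex.Re R) (v *m cmx B)) +
    qform (A - a%:M) (map_mx (@complex.Im R) (v *m cmx B))).
  rewrite hE; apply: sumr_ge0 => j _; have [jJ|] := boolP (j \in J).
    suff -> : (v *m cmx B *m P^t*) 0 j = 0 by rewrite normr0 expr0n mulr0.
    have /rowP/(_ (enum_rank_in jJ j)) := vN; rewrite [RHS]mxE => vNj.
    rewrite -mulmxA -[RHS]vNj ![(v *m _) _ _]mxE.
    by apply: eq_bigr => i _; rewrite [N _ _]mxE enum_rankK_in.
  by rewrite inE -leNgt => aD; rewrite mulr_ge0 ?exprn_ge0 // ler0c subr_ge0.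
rewrite ler0c leNgt => /negP; apply.
have ReB : map_mx (@complex.Re R) (v *m cmx B) = map_mx (@complex.Re R) v *m B.
  apply/rowP=> j; rewrite !mxE raddf_sum; apply: eq_bigr => i _.
  by rewrite !mxE /=; case: (v 0 i) => x y /=; rewrite mulr0 subr0.
have ImB : map_mx (@complex.Im R) (v *m cmx B) = map_mx (@complex.Im R) v *m B.
  apply/rowP=> j; rewrite !mxE raddf_sum; apply: eq_bigr => i _.
  by rewrite !mxE /=; case: (v 0 i) => x y /=; rewrite mulr0 add0r.
rewrite ReB ImB.
have q0 : qform (A - a%:M) (0 *m B) = 0 by rewrite /qform !mul0mx mxE.
(* The vector [v] is complex: one of its two parts is nonzero and gives a negative value, and the
   other gives at most zero. *)
have [x0|x0] := eqVneq (map_mx (@complex.Re R) v) 0; last first.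
  have := negB _ x0; have [->|y0] := eqVneq (map_mx (@complex.Im R) v) 0.
    by rewrite q0 addr0.
  by have := negB _ y0; lra.
rewrite x0 q0 add0r negB //; apply: contra_neq v0 => y0; apply/rowP=> j.
have /rowP/(_ j) := x0; have /rowP/(_ j) := y0; rewrite !mxE.
by case: (v 0 j) => x y /= -> ->.
Qed.

(** Were [k] smaller than the number of eigenvalues below [a], the span of their eigenvectors would
    contain a nonzero vector killed by [K], and the form is negative there. *)
Lemma nonnegative_subspace_eig_count k (K : 'M[R]_(n, k)) a :
  (forall x, x *m K = 0 -> 0 <= qform (A - a%:M) x) -> (eig_count_lt a <= k)%N.
Proof.
move=> posK; have [P [D [PP' PP AE ->]]] := eig_count_lt_spectral a.
set J := [set j | _]; rewrite leqNgt; apply/negP => kJ.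
(* [E] places coefficients indexed by [J] among all coordinates, so the rows of [E *m P] are the
   eigenvectors for eigenvalues below [a]. *)
pose E : 'M[C]_(#|J|, n) := \matrix_(i, j) (enum_val i == j)%:R.
have [v v0 vN] := exists_left_kernel (E *m P *m cmx K) kJ.
have := hermitian_form_diag a (v *m E *m P) PP AE.
rewrite hermitian_form_Re_Im ?trmx_sub_scalar // -[_ *m P *m _]mulmxA PP' mulmx1.
set z := v *m E *m P => hE.
have zK : z *m cmx K = 0 by rewrite -vN !mulmxA.
have ReK : map_mx (@complex.Re R) z *m K = 0.
  apply/rowP=> j; rewrite [RHS]mxE.
  have <- : complex.Re ((z *m cmx K) 0 j) = 0 by rewrite zK mxE.
  rewrite ![(_ *m _) _ _]mxE raddf_sum; apply: eq_bigr => i _.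
  by rewrite ![map_mx _ _ _ _]mxE /=; case: (z 0 i) => x y /=; rewrite mulr0 subr0.
have ImK : map_mx (@complex.Im R) z *m K = 0.
  apply/rowP=> j; rewrite [RHS]mxE.
  have <- : complex.Im ((z *m cmx K) 0 j) = 0 by rewrite zK mxE.
  rewrite ![(_ *m _) _ _]mxE raddf_sum; apply: eq_bigr => i _.
  by rewrite ![map_mx _ _ _ _]mxE /=; case: (z 0 i) => x y /=; rewrite mulr0 add0r.
have : 0 <= toC (qform (A - a%:M) (map_mx (@complex.Re R) z) +
    qform (A - a%:M) (map_mx (@complex.Im R) z)) by rewrite ler0c addr_ge0 ?posK.
rewrite hE => /le_gtF/negbT/negP; apply.
have vE i : (v *m E) 0 (enum_val i) = v 0 i.
  rewrite mxE (bigD1 i) //= mxE eqxx mulr1 big1 ?addr0 // => l li.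
  by rewrite mxE (inj_eq enum_val_inj) (negPf li) mulr0.
have [i vi] : exists i, v 0 i != 0 by case/rV0Pn: v0 => i vi; exists i.
have Jle j : toC (D 0 j - a) * `|(v *m E) 0 j| ^+ 2 <= 0.
  have [jJ|jJ] := boolP (j \in J).
    have Dj : toC (D 0 j - a) <= toC 0.
      by rewrite lecR subr_le0 ltW //; rewrite inE in jJ.
    by rewrite mulr_le0_ge0 ?exprn_ge0.
  suff -> : (v *m E) 0 j = 0 by rewrite normr0 expr0n mulr0.
  rewrite mxE big1 // => l _; rewrite mxE; case: eqP => [lj|]; rewrite ?mulr0 //.
  by rewrite -lj enum_valP in jJ.
have Di : toC (D 0 (enum_val i) - a) < toC 0.
  by rewrite ltcR subr_lt0; have := enum_valP i; rewrite inE.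
have lt0 : toC (D 0 (enum_val i) - a) * `|v 0 i| ^+ 2 < 0.
  by rewrite nmulr_rlt0 ?exprn_gt0 ?normr_gt0.
rewrite (bigD1 (enum_val i)) //= vE -[ltRHS]addr0.
by rewrite ltr_leD // sumr_le0.
Qed.

(** A nonnegative form has no negative eigenvalue, so the lower end of the interval excludes no
    root. *)
Lemma eig_count_itv (a : R) :
  (forall x, 0 <= qform A x) ->
  (\sum_(x <- rootsR (char_poly A) | x \in `[0, a[%R) mup x (char_poly A))%N
    = eig_count_lt a.
Proof.
move=> pos; rewrite /eig_count_lt big_seq_cond [RHS]big_seq_cond.
apply: eq_bigl => x; case xr: (x \in rootsR _) => //=; rewrite in_itv /=.
suff -> : 0 <= x by [].
have : root (char_poly A) x.
  by have := roots_on_rootsR (monic_neq0 (char_poly_monic A)) x; rewrite xr.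
rewrite -eigenvalue_root_char => /eigenvalueP[v vA v0].
have := pos v; rewrite /qform vA -scalemxAl mxE.
have vv : 0 < (v *m v^T) 0 0.
  case/rV0Pn: v0 => i vi; rewrite mxE (bigD1 i) //= mxE -expr2.
  rewrite ltr_wpDr ?sumr_ge0 ?lt_def ?sqr_ge0 ?sqrf_eq0 ?vi // => j _.
  by rewrite mxE -expr2 sqr_ge0.
by rewrite pmulr_lge0.
Qed.
End Inertia.

(** * The Laplacian form *)

Section LaplacianForm.
Local Open Scope ring_scope.
Variables (R : realType) (G : sgraph).
Local Notation L := (laplacian R G).
Implicit Type f : G -> R.

(** This is the Laplacian form: the two orientations of an edge between [u] and [w] together
    contribute [(f u - f w) ^+ 2]. *)
Definition energy f : R :=
  \sum_u \sum_w (adj u w)%:R * (f u ^+ 2 - f u * f w).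

Lemma energy_squares f :
  2 * energy f = \sum_u \sum_w (adj u w)%:R * (f u - f w) ^+ 2.
Proof.
have -> : 2 * energy f = energy f + energy f by ring.
rewrite {1}/energy exchange_big -big_split; apply: eq_bigr => u _.
rewrite -big_split; apply: eq_bigr => w _ /=.
by rewrite (adj_sym w u); ring.
Qed.

Lemma energy_ge0 f : 0 <= energy f.
Proof.
rewrite -(pmulr_rge0 _ (ltr0n R 2)) energy_squares.
by do 2!(apply: sumr_ge0 => ? _); rewrite mulr_ge0 ?sqr_ge0.
Qed.

Definition row_of f : 'rV[R]_#|G| := \row_i f (enum_val i).

Lemma row_ofP (x : 'rV[R]_#|G|) : exists f, x = row_of f.
Proof.
by exists (fun u => x 0 (enum_rank u)); apply/rowP=> i; rewrite mxE enum_valK.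
Qed.

Lemma laplacian_sym : L^T = L.
Proof.
apply/matrixP=> i j; rewrite !mxE adj_sym eq_sym.
by case: eqP => [->|].
Qed.

Lemma qform_laplacian f : qform L (row_of f) = energy f.
Proof.
rewrite /qform /energy mxE [RHS]big_enum_val; apply: eq_bigr => j _ /=.
have -> : (row_of f *m L) 0 j =
    \sum_w f w * ((degree w)%:R *+ (w == enum_val j) - (adj w (enum_val j))%:R).
  rewrite mxE [RHS]big_enum_val; apply: eq_bigr => i _ /=.
  by rewrite !mxE (inj_eq enum_val_inj).
set u := enum_val j; rewrite !mxE -/u mulr_suml.
have degE : (degree u)%:R = \sum_w (adj u w)%:R :> R.
  rewrite /degree -sum1_card big_mkcond natr_sum; apply: eq_bigr => w _.
  by rewrite inE; case: (adj u w).
under [LHS]eq_bigr => w _ do rewrite mulrBr mulrBl.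
under [RHS]eq_bigr => w _ do rewrite mulrBr.
rewrite !sumrB -[in RHS]mulr_suml -degE; congr (_ - _).
  rewrite (bigD1 u) //= eqxx big1 ?addr0; first by rewrite mulr1n; ring.
  by move=> w /negPf ->; rewrite mulr0n mulr0 mul0r.
by apply: eq_bigr => w _; rewrite adj_sym; ring.
Qed.

Lemma qform_laplacianB f (a : R) :
  qform (L - a%:M) (row_of f) = energy f - a * \sum_u f u ^+ 2.
Proof.
rewrite -qform_laplacian /qform mulmxBr mulmxBl mxE [X in _ + X]mxE; congr (_ - _).
rewrite mul_mx_scalar -scalemxAl mxE; congr (_ * _); rewrite mxE [RHS]big_enum_val.
by apply: eq_bigr => i _; rewrite !mxE expr2.
Qed.

Lemma laplacian_eig_countE (a : R) :
  laplacian_eig_count G `[0, a[ = eig_count_lt L a.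
Proof.
by apply: eig_count_itv => x; have [f ->] := row_ofP x;
  rewrite qform_laplacian energy_ge0.
Qed.

(** Negativity for every [s != 0] already makes the family injective, so no independence has to be
    checked for the test functions. *)
Lemma negative_test_functions m (F : 'rV[R]_m -> G -> R) (a : R) :
  (forall c s s' u, F (c *: s + s') u = c * F s u + F s' u) ->
  (forall s, s != 0 -> energy (F s) < a * \sum_u F s u ^+ 2) ->
  (m <= laplacian_eig_count G `[0%R, a[)%N.
Proof.
move=> Flin Fneg; rewrite laplacian_eig_countE.
have rlin : linear (fun s => row_of (F s)).
  by move=> c s s'; apply/rowP=> i; rewrite !mxE Flin.
pose H : {linear 'rV[R]_m -> 'rV[R]_#|G|} := HB.pack (fun s => row_of (F s))
  (GRing.isLinear.Build R 'rV[R]_m 'rV[R]_#|G| *:%R _ rlin).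
apply: (negative_subspace_eig_count laplacian_sym (B := lin1_mx H)) => v v0.
by rewrite mul_rV_lin1 qform_laplacianB subr_lt0 Fneg.
Qed.

(** If [f] vanishes on [D], each [u] off [D] has an edge into [D], which alone contributes
    [f u ^+ 2] to the energy; distinct [u] use distinct edges. *)
Lemma dominating_eig_count (D : {set G}) :
  (forall u, u \notin D -> exists2 w, w \in D & adj u w) ->
  (laplacian_eig_count G `[0%R : R, 1%R[ <= #|D|)%N.
Proof.
move=> dom; rewrite laplacian_eig_countE.
(* Multiplication by [K] restricts a function to [D]. *)
pose K : 'M[R]_(#|G|, #|D|) := \matrix_(i, j) (enum_val i == enum_val j)%:R.
apply: (nonnegative_subspace_eig_count laplacian_sym (K := K)) => x.
have [f ->] := row_ofP x; rewrite qform_laplacianB mul1r subr_ge0.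
move=> xK.
have fD u : u \in D -> f u = 0.
  move=> uD; have /rowP/(_ (enum_rank_in uD u)) := xK; rewrite [RHS]mxE => <-.
  rewrite mxE (bigD1 (enum_rank u)) //= !mxE !enum_rankK enum_rankK_in // eqxx mulr1.
  rewrite big1 ?addr0 // => i iu; rewrite !mxE enum_rankK_in //.
  by rewrite -(inj_eq enum_val_inj) enum_rankK in iu; rewrite (negPf iu) mulr0.
rewrite -(ler_pM2l (ltr0n R 2)) energy_squares.
pose S := \sum_u \sum_w (adj u w)%:R * ((w \in D)%:R * f u ^+ 2).
have fS : \sum_u f u ^+ 2 <= S.
  apply: ler_sum => u _; have [/fD ->|/dom[w wD uw]] := boolP (u \in D).
    by rewrite expr0n big1 // => w _; rewrite !mulr0.
  rewrite (bigD1 w) //= wD uw !mul1r lerDl sumr_ge0 // => v _.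
  by do 2!(apply: mulr_ge0; first exact: ler0n); exact: sqr_ge0.
(* One copy of [S] is summed with the orientation reversed, so that the comparison holds term by
   term over ordered pairs. *)
suff : S + S <= \sum_u \sum_w (adj u w)%:R * (f u - f w) ^+ 2 by lra.
rewrite {2}/S exchange_big -big_split; apply: ler_sum => u _.
rewrite -big_split; apply: ler_sum => w _ /=; rewrite (adj_sym w u) -mulrDr.
apply: ler_wpM2l => //; case: (boolP (u \in D)) => [/fD ->|_];
  case: (boolP (w \in D)) => [/fD ->|_]; 
  have := sqr_ge0 (f u - f w); rewrite ?mulr1n ?mulr0n; lra.
Qed.

End LaplacianForm.

(** * Rooted trees *)

Section Distance.
Variable G : sgraph.
Implicit Types x y : G.

Lemma has_walkP x y k :
  reflect (exists p, [/\ path adj x p, last x p = y & size p = k]) (has_walk x y k).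
Proof.
apply: (iffP existsP) => [[p /andP[xp /eqP ly]]|[p [xp ly /eqP sp]]].
  by exists p; rewrite size_tuple.
by exists (Tuple sp); rewrite /= xp ly eqxx.
Qed.

Lemma dist_le_size x p : path adj x p -> dist x (last x p) <= size p.
Proof.
move=> xp; rewrite leqNgt; apply/negP => lt.
have /(before_find 0) := lt; rewrite nth_iota; last first.
  by apply: leq_trans lt _; rewrite -[leqRHS](size_iota 0); apply: find_size.
by rewrite add0n => /negbT/negP; apply; apply/has_walkP; exists p.
Qed.

Lemma dist_walk x y : connect adj x y ->
  exists p, [/\ path adj x p, last x p = y & size p = dist x y].
Proof.
case/connectP=> p /shortenP[q xq Uq _] ->.
(* A walk without repetition is shorter than [#|G|], so the search defining [dist] succeeds and the
   junk value is not taken. *)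
have lt : size q < #|G| by have := max_card (mem (x :: q)); rewrite (card_uniqP Uq).
have hs : has (has_walk x (last x q)) (iota 0 #|G|).
  apply/hasP; exists (size q); first by rewrite mem_iota.
  by apply/has_walkP; exists q.
have := nth_find 0 hs; rewrite nth_iota ?add0n; first by move/has_walkP.
by rewrite -[X in _ < X](size_iota 0) -has_find.
Qed.

Lemma diameter_walk : 0 < #|G| -> exists x y, dist x y = diameter G.
Proof.
move=> G0; have [x] := @bigop.eq_bigmax G (fun x => \max_y dist x y) G0.
have [y yE] := @bigop.eq_bigmax G (fun y => dist x y) G0.
by rewrite -/(diameter G) yE => ->; exists x, y.
Qed.

End Distance.

(** A repetition-free path from [w1] to [w2] avoiding [u] closes up through [u] into a cycle, of
    size at least 3 unless the path is trivial. *)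
Lemma acyclic_neighbours (G : sgraph) (u w1 w2 : G) : acyclic G ->
  adj u w1 -> adj u w2 ->
  connect [rel x y | [&& adj x y, x != u & y != u]] w1 w2 -> w1 = w2.
Proof.
move=> acy uw1 uw2 /connectP[p /shortenP[q w1q Uq _] lq].
have w1u : w1 != u by apply: contraTneq uw1 => ->; rewrite adj_irr.
have uq : u \notin q.
  elim: q (w1) {Uq lq} w1q => //= y q IH x /andP[/and3P[_ _ yu] /IH uq].
  by rewrite inE negb_or eq_sym yu.
have aq : path adj w1 q by apply: sub_path w1q => x y /and3P[].
have /acy : ucycle adj [:: u, w1 & q].
  rewrite /ucycle /= rcons_path -lq uw1 aq adj_sym uw2 /=.
  by rewrite inE negb_or eq_sym w1u uq.
by case: q lq {w1q Uq uq aq}.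
Qed.

Section RootedTree.
Variables (G : sgraph) (r : G).
Hypothesis G_tree : is_tree G.

Definition depth (u : G) := dist r u.

(** The root is its own parent, so that differences between a vertex and its parent vanish there.
    Elsewhere the default is never reached, as [parentP] shows. *)
Definition parent (u : G) : G :=
  if u == r then r else odflt r [pick w | adj u w && (depth w < depth u)].

Lemma depth_walk u : exists p, [/\ path adj r p, last r p = u & size p = depth u].
Proof. by apply: dist_walk; case: G_tree => -[]. Qed.

Lemma depth_root : depth r = 0.
Proof. by apply/eqP; rewrite -leqn0 (@dist_le_size _ r [::]). Qed.

Lemma depth_adj u w : adj u w -> depth w <= (depth u).+1.
Proof.
move=> uw; have [p [rp lp <-]] := depth_walk u.
have := @dist_le_size _ r (rcons p w); rewrite last_rcons size_rcons.
by apply; rewrite rcons_path rp lp.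
Qed.

Lemma parent_root : parent r = r.
Proof. by rewrite /parent eqxx. Qed.

Lemma parentP u : u != r -> adj u (parent u) /\ depth (parent u) < depth u.
Proof.
move=> ur; rewrite /parent (negPf ur); case: pickP => [w /andP[]//|no].
have [p [rp lp sp]] := depth_walk u.
case/lastP: p => [|p w] in rp lp sp; first by rewrite -lp eqxx in ur.
have := no (last r p); rewrite last_rcons in lp; rewrite lp rcons_path in rp.
case/andP: rp => rp pu; rewrite adj_sym pu -sp size_rcons ltnS.
by rewrite /depth dist_le_size.
Qed.

Lemma depth_parent u : u != r -> depth u = (depth (parent u)).+1.
Proof.
move=> /parentP[up lt]; apply/eqP; rewrite eqn_leq lt andbT.
by apply: depth_adj; rewrite adj_sym.
Qed.

(** On a shortest walk from [r] to [w], every vertex other than the end is strictly less deep than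
    [w]. *)
Lemma connect_avoiding u w : depth w <= depth u -> w != u ->
  connect [rel x y | [&& adj x y, x != u & y != u]] r w.
Proof.
move=> wu wnu; have [p [rp lp sp]] := depth_walk w.
have up : u \notin r :: p.
  apply/negP => /splitPl up; case: up rp lp sp => p1 p2 lp1.
  rewrite cat_path last_cat lp1 size_cat => /andP[rp1 _] lp2 sp.
  have := dist_le_size rp1; rewrite lp1 -/(depth u) => du.
  have := leq_trans wu du; rewrite -sp -leq_subRL // subnn leqn0 size_eq0 => /eqP p20.
  by move: wnu; rewrite -lp2 p20 eqxx.
apply/connectP; exists p => //; elim: p (r) up rp {lp sp} => //= y p IH x.
rewrite !inE !negb_or => /and3P[ux uy up] /andP[xy yp].
by rewrite xy eq_sym ux eq_sym uy IH // inE negb_or uy.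
Qed.

(** Both [w] and [parent u] are joined to [r] by walks avoiding [u], so acyclicity identifies them.
    This also rules out edges between vertices of equal depth. *)
Lemma lower_neighbour u w : adj u w -> depth w <= depth u ->
  u != r /\ w = parent u.
Proof.
move=> uw wu; have wnu : w != u by apply: contraTneq uw => ->; rewrite adj_irr.
have ur : u != r.
  apply: contraNneq wnu => ur; move: wu; rewrite ur depth_root leqn0 => /eqP w0.
  have [p [_ lp]] := depth_walk w; rewrite w0 => /size0nil p0.
  by rewrite -lp p0.
split=> //; have [up lt] := parentP ur.
apply: (acyclic_neighbours (proj2 G_tree) uw up).
have sym : connect_sym [rel x y | [&& adj x y, x != u & y != u]].
  by apply: sym_connect_sym => x y /=; rewrite adj_sym; congr (_ && _); apply: andbC.
apply: connect_trans (connect_avoiding (ltnW lt) _).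
  by rewrite sym connect_avoiding.
by apply: contraTneq lt => ->; rewrite ltnn.
Qed.

Lemma adj_parent u w :
  adj u w = (u != r) && (w == parent u) || (w != r) && (u == parent w).
Proof.
apply/idP/idP => [uw|/orP[]/andP[ne /eqP ->]]; last 2 first.
- by case: (parentP ne).
- by rewrite adj_sym; case: (parentP ne).
case: (leqP (depth w) (depth u)) => [|/ltnW] wu.
  by have [-> ->] := lower_neighbour uw wu; rewrite eqxx.
rewrite adj_sym in uw.
by have [-> ->] := lower_neighbour uw wu; rewrite eqxx orbT.
Qed.

Lemma parent_antisym u w : u != r -> w != r -> w = parent u -> u <> parent w.
Proof.
move=> ur wr wu uw; have := depth_parent ur; have := depth_parent wr.
by rewrite -wu -uw; lia.
Qed.

Local Open Scope ring_scope.

(** Every edge joins exactly one non-root vertex to its parent. *)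
Lemma energy_parent (R : realType) (f : G -> R) :
  energy f = \sum_u (f u - f (parent u)) ^+ 2.
Proof.
pose a u w : R := ((u != r) && (w == parent u))%:R.
have aE u w : (adj u w)%:R = a u w + a w u.
  rewrite /a adj_parent; have [ur|] := boolP (u != r); rewrite ?add0r //=.
  have [wr|] := boolP (w != r); rewrite ?addr0 ?orbF //=.
  have [/(parent_antisym ur wr) uw|_] := eqVneq w (parent u); last by rewrite add0r.
  by case: eqP => // _; rewrite addr0.
have aS (g : G -> R) u : \sum_w a u w * g w = (u != r)%:R * g (parent u).
  rewrite (bigD1 (parent u)) //= big1 ?addr0; first by rewrite /a eqxx andbT.
  by move=> w /negPf wu; rewrite /a wu andbF mul0r.
rewrite /energy.
have -> : \sum_u \sum_w (adj u w)%:R * (f u ^+ 2 - f u * f w) =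
   \sum_u \sum_w a u w * (f u ^+ 2 - f u * f w) +
   \sum_u \sum_w a w u * (f u ^+ 2 - f u * f w).
  rewrite -big_split; apply: eq_bigr => u _; rewrite -big_split.
  by apply: eq_bigr => w _; rewrite aE mulrDl.
rewrite [X in _ + X]exchange_big -big_split; apply: eq_bigr => u _ /=.
rewrite (aS (fun w => f u ^+ 2 - f u * f w)) (aS (fun w => f w ^+ 2 - f w * f u)).
have [->|_] := eqVneq u r; rewrite ?parent_root /=; ring.
Qed.

End RootedTree.

(** * Test functions along a path *)

Section Projection.
Variables (G : sgraph) (r : G).
Hypothesis G_tree : is_tree G.
Variable S : {set G}.
Hypothesis rS : r \in S.

(** Climbs from [u] to the first vertex of [S]. The root lies in [S], so [depth r u] steps suffice,
    and surplus steps do not move. *)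
Definition proj (u : G) : G :=
  iter (depth r u) (fun w => if w \in S then w else parent r w) u.

Lemma proj_id u : u \in S -> proj u = u.
Proof. by move=> uS; apply: iter_fix; rewrite uS. Qed.

Lemma proj_parent u : u \notin S -> proj (parent r u) = proj u.
Proof.
move=> uS; have ur : u != r by apply: contraNneq uS => ->.
by rewrite /proj (depth_parent G_tree ur) iterSr (negPf uS).
Qed.

Lemma proj_in u : proj u \in S.
Proof.
have [m] := ubnP (depth r u); elim: m u => // m IH u um.
have [uS|uS] := boolP (u \in S); first by rewrite proj_id.
have ur : u != r by apply: contraNneq uS => ->.
rewrite -proj_parent // IH //; have [_] := parentP G_tree ur.
by move/leq_trans; apply.
Qed.
End Projection.

Section PathValues.
Variable R : realType.
Implicit Types t : nat -> R.
Local Open Scope ring_scope.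

(* On the block of path vertices 3m, 3m+1, 3m+2 the test function takes the
   values t_m, (t_m + t_(m+1)) / 2, t_(m+1), so the edges between blocks do not
   contribute. *)
Definition midval t m : R := (t m + t m.+1) / 2.

Definition pathval t j : R :=
  match (j %% 3)%N with
  | 0%N => t (j %/ 3)%N
  | 1%N => midval t (j %/ 3)
  | _ => t (j %/ 3).+1
  end.

Lemma pathval_block t m :
  [/\ pathval t (3 * m) = t m, pathval t (3 * m).+1 = midval t m
    & pathval t (3 * m).+2 = t m.+1].
Proof.
have e0 : ((3 * m) %% 3 = 0)%N by lia.
have e1 : ((3 * m).+1 %% 3 = 1)%N by lia.
have e2 : ((3 * m).+2 %% 3 = 2)%N by lia.
have d0 : ((3 * m) %/ 3 = m)%N by lia.
have d1 : ((3 * m).+1 %/ 3 = m)%N by lia.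
have d2 : ((3 * m).+2 %/ 3 = m)%N by lia.
by rewrite /pathval e0 e1 e2 d0 d1 d2.
Qed.

(** A block with end values a, c and middle b = (a + c) / 2 gives (b - a)^2 + (c - b)^2 - a^2 - b^2
    - c^2 = - 3 b^2. At [j = 0] the predecessor is 0 again, so the root has no edge term. *)
Lemma pathval_form t k :
  \sum_(j < 3 * k) ((pathval t j - pathval t j.-1) ^+ 2 - pathval t j ^+ 2) =
  - 3 * \sum_(m < k) midval t m ^+ 2.
Proof.
elim: k => [|k IH]; first by rewrite muln0 !big_ord0 mulr0.
have -> : (3 * k.+1 = (3 * k).+3)%N by lia.
rewrite !big_ord_recr /= IH.
have [-> -> ->] := pathval_block t k.
have -> : pathval t (3 * k).-1 = t k.
  case: k {IH} => [|k]; first by rewrite muln0 /pathval.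
  have -> : ((3 * k.+1).-1 = (3 * k).+2)%N by lia.
  by have [_ _ ->] := pathval_block t k.
by rewrite /midval; field.
Qed.

(** Vanishing middle values force [t i.+1 = - t i], so a single zero spreads to all entries. *)
Lemma alternating_eq0 t k j : (forall m, (m < k)%N -> midval t m = 0) ->
  (j <= k)%N -> t j = 0 -> forall i, (i <= k)%N -> t i = 0.
Proof.
move=> mid jk tj; have tE i : (i <= k)%N -> t i = (-1) ^+ i * t 0.
  elim: i => [|i IH] ik; first by rewrite mul1r.
  have := mid i ik; rewrite /midval IH 1?ltnW // exprS.
  by move=> h; lra.
have t0 : t 0 = 0.
  by have := tE j jk; rewrite tj => /esym/eqP; rewrite mulf_eq0 signr_eq0 => /eqP.
by move=> i /tE ->; rewrite t0 mulr0.
Qed.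

(** Extension by zero supplies the condition t_k = 0 when there are only [k] parameters. *)
Definition coef m (s : 'rV[R]_m) (j : nat) : R :=
  if insub j is Some i then s 0 i else 0.

Lemma coefD m c (s s' : 'rV[R]_m) j :
  coef (c *: s + s') j = c * coef s j + coef s' j.
Proof. by rewrite /coef; case: insubP => [i _ _|_]; rewrite ?mxE ?mulr0 ?addr0. Qed.

Lemma coef_oob m (s : 'rV[R]_m) j : (m <= j)%N -> coef s j = 0.
Proof. by rewrite /coef leqNgt; case: insubP => [i -> //|]. Qed.

Lemma coef_eq0 m (s : 'rV[R]_m) : (forall j, (j < m)%N -> coef s j = 0) -> s = 0.
Proof.
move=> s0; apply/rowP=> i; rewrite mxE -(s0 i) // /coef.
by case: insubP => [l _ /val_inj ->//|]; rewrite ltn_ord.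
Qed.

Lemma pathvalD (t t1 t2 : nat -> R) c : (forall j, t j = c * t1 j + t2 j) ->
  forall j, pathval t j = c * pathval t1 j + pathval t2 j.
Proof.
move=> tE j; rewrite /pathval /midval !tE.
by case: (j %% 3)%N => [|[|n]] //; ring.
Qed.

End PathValues.

(** * Lower bounds on the eigenvalue count from a long path and its branches *)

Section LongPath.
Variables (R : realType) (G : sgraph) (r : G) (v : nat -> G) (k : nat).
Hypothesis G_tree : is_tree G.
Hypothesis v_root : v 0 = r.
Hypothesis k_gt0 : 0 < k.
Hypothesis v_depth : forall j, j < 3 * k -> depth r (v j) = j.
Hypothesis v_parent : forall j, j < 3 * k -> parent r (v j) = v j.-1.
Local Notation m_G := (laplacian_eig_count G `[0%R : R, 1%R[%R).
Local Notation par := (parent r).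
Local Notation depth := (depth r).

Definition pathset : {set G} := [set v j | j : 'I_(3 * k)].

Lemma pathsetP u : reflect (exists2 j, j < 3 * k & u = v j) (u \in pathset).
Proof.
apply: (iffP imsetP) => [[j _ ->]|[j jk ->]]; first by exists j.
by exists (Ordinal jk).
Qed.

Lemma root_pathset : r \in pathset.
Proof. by apply/pathsetP; exists 0; rewrite ?v_root //; lia. Qed.

Lemma parent_pathset u : u \in pathset -> par u \in pathset.
Proof.
case/pathsetP=> j jk ->; rewrite v_parent //; apply/pathsetP.
by exists j.-1 => //; lia.
Qed.

Local Open Scope ring_scope.

(** Each edge is charged to its deeper end, and the path is closed under [par], so the path vertices
    contribute exactly the sum of [pathval_form]. *)
Lemma energy_pathset (f : G -> R) (t : nat -> R) :
  (forall j, (j < 3 * k)%N -> f (v j) = pathval t j) ->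
  energy f - \sum_u f u ^+ 2 = - 3 * \sum_(m < k) midval t m ^+ 2 +
    \sum_(u | u \notin pathset) ((f u - f (par u)) ^+ 2 - f u ^+ 2).
Proof.
move=> fv; rewrite (energy_parent r) // -sumrB (bigID (mem pathset)) /=; congr (_ + _).
rewrite -pathval_form big_imset /=; last first.
  by move=> i j _ _ /(congr1 depth); rewrite !v_depth // => /val_inj.
apply: eq_big => // j _; rewrite v_parent // !fv //.
by have := ltn_ord j; lia.
Qed.

Lemma midval_sum_gt0 (t : nat -> R) :
  (forall m, (m < k)%N -> midval t m = 0) \/ 0 < \sum_(m < k) midval t m ^+ 2.
Proof.
have [/eqP|] := eqVneq (\sum_(m < k) midval t m ^+ 2) 0.
  rewrite psumr_eq0 => [/allP t0|m _]; last exact: sqr_ge0.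
  left=> m mk; have := t0 (Ordinal mk); rewrite mem_index_enum sqrf_eq0.
  by move=> /(_ isT)/eqP.
by right; rewrite lt_def sumr_ge0 ?andbT // => m _; apply: sqr_ge0.
Qed.

(** On the path the depth recovers the index of [v j]; composing with [proj] makes the function
    constant along branches. *)
Definition pathext (t : nat -> R) (u : G) : R := pathval t (depth (proj r pathset u)).

Lemma pathext_path t j : (j < 3 * k)%N -> pathext t (v j) = pathval t j.
Proof.
by move=> jk; rewrite /pathext proj_id ?v_depth //; apply/pathsetP; exists j.
Qed.

Lemma energy_pathext t : energy (pathext t) - \sum_u pathext t u ^+ 2 =
  - 3 * \sum_(m < k) midval t m ^+ 2 - \sum_(u | u \notin pathset) pathext t u ^+ 2.
Proof.
rewrite (energy_pathset (t := t)); last exact: pathext_path.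
congr (_ + _); rewrite -sumrN; apply: eq_bigr => u uP.
by rewrite /pathext proj_parent ?root_pathset // subrr expr0n add0r.
Qed.

Lemma pathextD (t t1 t2 : nat -> R) c : (forall j, t j = c * t1 j + t2 j) ->
  forall u, pathext t u = c * pathext t1 u + pathext t2 u.
Proof. by move=> tE u; rewrite /pathext (pathvalD tE). Qed.

Lemma long_path_eig_count : (k <= m_G)%N.
Proof.
apply: (negative_test_functions (F := fun s => pathext (coef s))).
  by move=> c s s' u; apply: pathextD => j; apply: coefD.
move=> s s0; rewrite mul1r -subr_lt0 energy_pathext.
have P0 : 0 <= \sum_(u | u \notin pathset) pathext (coef s) u ^+ 2.
  by apply: sumr_ge0 => u _; apply: sqr_ge0.
have [mid0|] := midval_sum_gt0 (coef s); last by lra.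
case/eqP: s0; apply: coef_eq0 => j jk.
exact: (alternating_eq0 mid0 (leqnn k) (coef_oob s (leqnn k)) (ltnW jk)).
Qed.

(** With [k.+1] parameters t_k is free. Only the alternating direction makes the path part vanish,
    and there the value at [u] is nonzero. *)
Lemma branch_off_centre_eig_count (u : G) : u \notin pathset ->
  (depth (proj r pathset u) %% 3 != 1)%N -> (k.+1 <= m_G)%N.
Proof.
move=> uP u3; apply: (negative_test_functions (F := fun s => pathext (coef s))).
  by move=> c s s' w; apply: pathextD => j; apply: coefD.
move=> s s0; rewrite mul1r -subr_lt0 energy_pathext.
have P0 : pathext (coef s) u ^+ 2 <=
    \sum_(w | w \notin pathset) pathext (coef s) w ^+ 2.
  by rewrite (bigD1 u) //= lerDl sumr_ge0 // => w _; apply: sqr_ge0.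
have u0 := sqr_ge0 (pathext (coef s) u).
have [mid0|] := midval_sum_gt0 (coef s); last by lra.
have M0 : \sum_(m < k) midval (coef s) m ^+ 2 = 0.
  by rewrite big1 // => m _; rewrite mid0 // expr0n.
suff ut : pathext (coef s) u ^+ 2 != 0.
  have : 0 < pathext (coef s) u ^+ 2 by rewrite lt_def ut.
  by rewrite M0; lra.
rewrite sqrf_eq0; apply: contraNneq s0 => eu.
(* Residues 0 and 2 modulo 3 are the ends of a block, where the path function is an entry of [t]
   itself. *)
have [i ik ti] : exists2 i, (i <= k)%N & coef s i = 0.
  have /pathsetP[j jk pE] := proj_in G_tree root_pathset u.
  move: eu u3; rewrite /pathext pE v_depth // /pathval.
  case: (j %% 3)%N (ltn_pmod j (isT : (0 < 3)%N)) => [|[|[|//]]] _ // tj _.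
    by exists (j %/ 3)%N => //; lia.
  by exists (j %/ 3).+1 => //; lia.
by apply/eqP/coef_eq0 => j jk; apply: (alternating_eq0 mid0 ik ti).
Qed.

Lemma deep_branch_eig_count (a u : G) : a \notin pathset -> par a \in pathset ->
  (depth (par a) %% 3 = 1)%N -> par u = a -> u != a -> (k.+1 <= m_G)%N.
Proof.
move=> aP paP pa3 ua una.
(* Adding [a] to the set projected onto lets the branch behind [a] carry its own value. *)
set S := a |: pathset; have rS : r \in S by rewrite !inE root_pathset orbT.
(* The last of the [k.+1] parameters is the branch value; it is cut from the path sequence, which
   therefore ends with [t s k = 0]. *)
pose t (s : 'rV[R]_k.+1) j : R := if (j < k)%N then coef s j else 0.
pose F s w : R := if proj r S w == a then coef s k
                  else pathval (t s) (depth (proj r S w)).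
have uP : u \notin pathset.
  by apply: contra aP => uP; rewrite -ua parent_pathset.
have uS : u \notin S by rewrite !inE negb_or una.
have pF s w : w \notin S -> F s (par w) = F s w.
  by move=> wS; rewrite /F proj_parent.
have Fa s : F s a = coef s k by rewrite /F proj_id ?eqxx // !inE eqxx.
have FP s w : w \in pathset -> F s w = pathval (t s) (depth w).
  move=> wP; rewrite /F proj_id ?inE ?wP ?orbT //.
  by case: eqP => // wa; rewrite -wa wP in aP.
apply: (negative_test_functions (F := F)).
  move=> c s s' w; rewrite /F; case: ifP => _; first exact: coefD.
  apply: pathvalD => j; rewrite /t; case: ifP => _; first exact: coefD.
  by rewrite mulr0 addr0.
move=> s s0; rewrite mul1r -subr_lt0 (energy_pathset (t := t s)); last first.
  by move=> j jk; rewrite FP ?v_depth //; apply/pathsetP; exists j.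
have [i ik pai] : exists2 i, (i < k)%N & F s (par a) = midval (t s) i.
  rewrite FP // /pathval pa3; exists (depth (par a) %/ 3)%N => //.
  by case/pathsetP: paP => j jk ->; rewrite v_depth //; lia.
(* Off the path only [a] may differ in value from its parent; [u] shares the value of [a] and
   contributes [- y ^+ 2]. *)
rewrite (bigD1 a) //= (bigD1 u) /=; last by rewrite uP.
have Fu : F s u = coef s k by rewrite -pF // ua Fa.
rewrite ua Fu Fa pai subrr expr0n add0r.
set b := midval (t s) i; set y := coef s k.
set M := \sum_(m < k) _; set Q := \sum_(w | _) _.
have Q0 : Q <= 0.
  apply: sumr_le0 => w /andP[/andP[wP wa] _].
  have wS : w \notin S by rewrite !inE negb_or wa.
  by rewrite pF // subrr expr0n add0r oppr_le0 sqr_ge0.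
have bM : b ^+ 2 <= M.
  by rewrite /M (bigD1 (Ordinal ik)) //= lerDl sumr_ge0 // => m _; apply: sqr_ge0.
have yb := sqr_ge0 (y + b).
have [mid0|M0] := midval_sum_gt0 (t s); last first.
  (* The factor 3 in the path form absorbs the 2 b^2 lost on the edge to a. *)
  have -> : (y - b) ^+ 2 - y ^+ 2 = 2 * b ^+ 2 + y ^+ 2 - (y + b) ^+ 2 by ring.
  by rewrite -/M in M0; lra.
have M0 : M = 0 by rewrite /M big1 // => m _; rewrite mid0 // expr0n.
have b0 : b = 0 by apply: mid0.
suff y0 : y != 0.
  have : 0 < y ^+ 2 by rewrite lt_def sqrf_eq0 y0 sqr_ge0.
  by rewrite M0 b0 subr0; lra.
apply: contraNneq s0 => y0; apply/eqP/coef_eq0 => j; rewrite ltnS leq_eqVlt.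
case/predU1P=> [->//|jk].
have tk : t s k = 0 by rewrite /t ltnn.
by have := alternating_eq0 mid0 (leqnn k) tk (ltnW jk); rewrite /t jk.
Qed.

End LongPath.

(** * The trees of Gamma(n, d) *)

(** On a shortest walk realising the diameter, the initial segment bounds the depth of [v j] by [j];
    the remaining steps must still reach full depth, which gives the converse bound. *)
Lemma diametral_path (G : sgraph) : is_tree G -> exists (r : G) (v : nat -> G),
  [/\ v 0 = r, forall j, j <= diameter G -> depth r (v j) = j
    & forall j, j <= diameter G -> parent r (v j) = v j.-1].
Proof.
move=> tG; have [[G0 conn] _] := tG.
have [r [y dE]] := diameter_walk G0; rewrite -dE.
have [p [rp lp sp]] := dist_walk (conn r y).
pose v j := nth r (r :: p) j; rewrite -sp in dE *.
have le_depth j : j <= size p -> depth r (v j) <= j.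
  move=> jp; have := dist_le_size (take_path j rp).
  rewrite (last_nth r) size_takel //.
  suff -> : nth r (r :: take j p) j = v j by [].
  by rewrite -[r :: _]/(take j.+1 (r :: p)) nth_take.
have adj_v j : j < size p -> adj (v j) (v j.+1) by move=> jp; apply: (pathP r rp).
have depth_add i j : j + i <= size p -> depth r (v (j + i)) <= depth r (v j) + i.
  elim: i => [|i IH]; rewrite ?addn0 // !addnS => ji.
  by apply: leq_trans (depth_adj r tG (adj_v _ ji)) _; rewrite ltnS IH // ltnW.
have v_depth j : j <= size p -> depth r (v j) = j.
  move=> jp; apply/eqP; rewrite eqn_leq le_depth //=.
  have := depth_add (size p - j) j; rewrite subnKC // => /(_ (leqnn _)).
  have -> : v (size p) = y by rewrite -lp (last_nth r).
  by rewrite [depth r y](esym sp) addnC -leq_subLR subKn.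
exists r, v; split=> // -[|j] jp; first by rewrite parent_root.
have [] := lower_neighbour (r := r) tG (u := v j.+1) (w := v j).
- by rewrite adj_sym adj_v.
- by rewrite !v_depth // ltnW.
by move=> _ <-.
Qed.

Lemma Gamma_eig_count (R : realType) n d (T : sgraph) : Gamma n d T ->
  laplacian_eig_count T `[0%R : R, 1%R[%R <= (d + 1) %/ 3.
Proof.
case=> d3 [ns [_ [f [g fK gK] fadj]]].
(* Indices start at 0 here, so the centre v_(3(i+1)-1) has index [3 * i + 1]. *)
have lt_c (i : 'I_((d + 1) %/ 3)) : 3 * i + 1 < d + 1 by have := ltn_ord i; lia.
pose c i : Hgraph ns := inl (Ordinal (lt_c i)).
pose D := [set g (c i) | i : 'I_((d + 1) %/ 3)].
have cD : #|D| <= (d + 1) %/ 3 by rewrite -[leqRHS]card_ord leq_imset_card.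
apply: leq_trans cD; apply: dominating_eig_count => u uD.
have [i ui] : exists i, adj (f u) (c i).
  have : forall i, f u <> c i.
    by move=> i ui; case/imsetP: uD; exists i => //; rewrite -ui fK.
  case: (f u) => [b|x] ne; last by exists (tag x) => /=; apply/eqP; lia.
  (* A path vertex that is not a centre has index 3q or 3q + 2, next to the centre 3q + 1 of its own
     block. *)
  have bk : b %/ 3 < (d + 1) %/ 3 by have := ltn_ord b; lia.
  exists (Ordinal bk) => /=.
  have : b <> 3 * (b %/ 3) + 1 :> nat.
    by move=> e; apply: (ne (Ordinal bk)); congr inl; apply: val_inj.
  lia.
exists (g (c i)); first by rewrite imset_f.
by rewrite -fadj gK.
Qed.

(** * Identification of a tree whose vertices off the path are pendant at centres *)

Section Recognition.
Variables (G : sgraph) (r : G) (v : nat -> G) (d : nat).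
Hypothesis G_tree : is_tree G.
Hypothesis d3 : d + 1 = 3 * ((d + 1) %/ 3).
Local Notation k := ((d + 1) %/ 3).
Hypothesis v_root : v 0 = r.
Hypothesis v_depth : forall j, j < 3 * k -> depth r (v j) = j.
Hypothesis v_parent : forall j, j < 3 * k -> parent r (v j) = v j.-1.
Local Notation P := (pathset v k).
Local Notation par := (parent r).
Hypothesis off_parent : forall u, u \notin P -> par u \in P.
Hypothesis off_depth : forall u, u \notin P -> depth r (par u) %% 3 = 1.

Lemma path_eq i j : i < 3 * k -> j < 3 * k -> (v i == v j) = (i == j).
Proof.
move=> ik jk; apply/eqP/eqP => [/(congr1 (depth r))|->//].
by rewrite !v_depth.
Qed.

Definition pendant (i : 'I_k) : {set G} :=
  [set u | (u \notin P) && (par u == v (3 * i + 1))].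

(** The map goes from the model to [G], where [enum_val] names the pendant vertices directly; the
    isomorphism sought is its inverse. *)
Definition of_H (h : Hgraph (fun i => #|pendant i|)) : G :=
  match h with
  | inl a => v a
  | inr x => @enum_val _ (mem (pendant (tag x))) (tagged x)
  end.

Lemma mem_path j : j < 3 * k -> v j \in P.
Proof. by move=> jk; apply/pathsetP; exists j. Qed.

Lemma pendantP (x : {i : 'I_k & 'I_#|pendant i|}) :
  of_H (inr x) \notin P /\ par (of_H (inr x)) = v (3 * tag x + 1).
Proof. by have := enum_valP (tagged x); rewrite inE => /andP[? /eqP]. Qed.

Lemma centre_lt (i : 'I_k) : 3 * i + 1 < 3 * k.
Proof. by have := ltn_ord i; lia. Qed.

Lemma of_H_inj : injective of_H.
Proof.
have dk (a : 'I_(d + 1)) : a < 3 * k by rewrite -d3.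
move=> [a|x] [b|y] /=.
- by move/eqP; rewrite path_eq // => /eqP/val_inj ->.
- by move=> e; have [/negP[]] := pendantP y; rewrite /= -e mem_path.
- by move=> e; have [/negP[]] := pendantP x; rewrite /= e mem_path.
move=> e; have [_] := pendantP x; have [_] := pendantP y; rewrite /= -e => ->.
move/eqP; rewrite path_eq ?centre_lt // => /eqP txy.
have {}txy : tag y = tag x by apply: val_inj => /=; lia.
by case: x y txy e => [i x] [j y] /= ij; rewrite ij in y * => /enum_val_inj ->.
Qed.

Lemma of_H_surj u : exists h, of_H h = u.
Proof.
have [/pathsetP[j jk ->]|uP] := boolP (u \in P).
  have jd : j < d + 1 by rewrite d3.
  by exists (inl (Ordinal jd)).
have /pathsetP[j jk pu] := off_parent uP.
have := off_depth uP; rewrite pu v_depth // => j3.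
have ik : j %/ 3 < k by lia.
have ui : u \in pendant (Ordinal ik).
  by rewrite inE uP pu path_eq //=; lia.
exists (inr (Tagged (fun i => 'I_#|pendant i|) (enum_rank_in ui u))).
by rewrite /of_H /= enum_rankK_in.
Qed.

(** Adjacency in [G] is the parent relation, and every parent lies on the path, so a pendant vertex
    is adjacent only to its own parent. *)
Lemma of_H_adj : {mono of_H : x y / adj x y}.
Proof.
have dk (a : 'I_(d + 1)) : a < 3 * k by rewrite -d3.
have k0 : 0 < 3 * k by rewrite -d3 addn1.
have vr (a : 'I_(d + 1)) : (v a == r) = (a == 0 :> nat) by rewrite -v_root path_eq.
have rP : r \in P by rewrite -v_root mem_path.
have mixed (a : 'I_(d + 1)) x : adj (v a) (of_H (inr x)) = (a == 3 * tag x + 1 :> nat).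
  have [xP px] := pendantP x; rewrite (adj_parent r G_tree) px.
  rewrite path_eq ?centre_lt // v_parent //.
  have -> : (of_H (inr x) == v a.-1) = false.
    by apply: contraNF xP => /eqP ->; rewrite mem_path //; have := dk a; lia.
  have -> : of_H (inr x) != r by apply: contraNneq xP => ->.
  by rewrite andbF.
have centreE i : 3 * i.+1 - 1 = (3 * i + 1).+1 by lia.
move=> [a|x] [b|y].
- by rewrite (adj_parent r G_tree) /= !vr !v_parent // !path_eq //;
    have := dk a; have := dk b; lia.
- by rewrite /= mixed centreE eqSS.
- by rewrite adj_sym /= mixed centreE eqSS.
rewrite (adj_parent r G_tree) /=.
have [xP px] := pendantP x; have [yP py] := pendantP y.
rewrite -[enum_val (tagged x)]/(of_H (inr x)).
rewrite -[enum_val (tagged y)]/(of_H (inr y)) px py.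
have -> : (of_H (inr y) == v (3 * tag x + 1)) = false.
  by apply: contraNF yP => /eqP ->; rewrite mem_path ?centre_lt.
have -> : (of_H (inr x) == v (3 * tag y + 1)) = false.
  by apply: contraNF xP => /eqP ->; rewrite mem_path ?centre_lt.
by rewrite !andbF.
Qed.

Lemma recognise_Gamma : Gamma #|G| d G.
Proof.
split; first lia.
exists (fun i => #|pendant i|).
have bij : bijective of_H.
  apply: inj_card_bij of_H_inj _; rewrite -(card_codom of_H_inj).
  apply: subset_leq_card; apply/subsetP => u _.
  by have [h <-] := of_H_surj u; apply: codom_f.
split.
  rewrite -(bij_eq_card bij) card_sum card_ord card_tagged sumnE big_map big_enum /=.
  under [in RHS]eq_bigr => i _ do rewrite card_ord.
  by rewrite -addnA addnC.
have [g gK Kg] := bij; exists g; first by exists of_H.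
by move=> x y; rewrite -of_H_adj !Kg.
Qed.
End Recognition.

Local Open Scope ring_scope.

Theorem theorem5 (R : realType) (n d : nat) (T : sgraph)
    (T_tree : is_tree T) (T_order : #|T| = n) (T_diam : diameter T = d) :
  (laplacian_eig_count T `[0%R : R, 1%R[)%:R = (d + 1)%:R / 3%:R :> R
  <-> Gamma n d T.
Proof.
have [r [v [v0 vd vp]]] := diametral_path T_tree; rewrite T_diam in vd vp.
set m := laplacian_eig_count _ _.
(* Clearing the denominator gives an equation in [nat], which also forces 3 to divide [d + 1]. *)
have -> : m%:R = (d + 1)%:R / 3 :> R <-> (d + 1 = 3 * m)%N.
  split=> [e|->]; last by rewrite natrM; field.
  by apply/eqP; rewrite -(eqr_nat R) natrM e; apply/eqP; field.
set k := ((d + 1) %/ 3)%N.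
have k0 : (d + 1 = 3 * k)%N -> (0 < k)%N by lia.
have vd' : (d + 1 = 3 * k)%N -> forall j, (j < 3 * k)%N -> depth r (v j) = j.
  by move=> dk j jk; apply: vd; lia.
have vp' : (d + 1 = 3 * k)%N -> forall j, (j < 3 * k)%N -> parent r (v j) = v j.-1.
  by move=> dk j jk; apply: vp; lia.
split=> [dm|GT]; last first.
  have dk : (d + 1 = 3 * k)%N by case: GT => d2 _; lia.
  have le_mk : (m <= k)%N := Gamma_eig_count R GT.
  have le_km := long_path_eig_count R T_tree v0 (k0 dk) (vd' dk) (vp' dk).
  by rewrite -/m in le_km; lia.
have mk : m = k by lia.
have dk : (d + 1 = 3 * k)%N by lia.
move: (k0 dk) (vd' dk) (vp' dk) => {}k0 {}vd' {}vp'.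
pose P := pathset v k.
(* A branch leaving the path elsewhere than at a centre would give [k.+1] eigenvalues, against
   [m = k]. *)
have proj3 u : u \notin P -> (depth r (proj r P u) %% 3 = 1)%N.
  move=> uP; apply/eqP; apply: contraT => u3.
  have := branch_off_centre_eig_count R T_tree v0 k0 vd' vp' uP u3.
  by rewrite -/m mk ltnn.
have rP : r \in P := root_pathset v0 k0.
(* Induction on depth: if the parent of [u] were off the path, its own parent would be on it by
   induction, so [u] would lie on a branch with at least two vertices, again giving [k.+1]
   eigenvalues. *)
have off_parent u : u \notin P -> parent r u \in P.
  have [l] := ubnP (depth r u); elim: l u => // l IH u ul uP.
  have ur : u != r by apply: contraNneq uP => ->.
  have [_ lt] := parentP T_tree ur; apply: contraT => aP.
  have paP : parent r (parent r u) \in P by apply: IH => //; apply: leq_trans lt _.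
  have una : u != parent r u by apply: contraTneq lt => <-; rewrite ltnn.
  have pa3 : (depth r (parent r (parent r u)) %% 3 = 1)%N.
    by have := proj3 _ aP; rewrite -(proj_parent T_tree rP aP) proj_id.
  have := deep_branch_eig_count R T_tree v0 k0 vd' vp' aP paP pa3 erefl una.
  by rewrite -/m mk ltnn.
have off_depth u : u \notin P -> (depth r (parent r u) %% 3 = 1)%N.
  move=> uP; have := proj3 _ uP; rewrite -(proj_parent T_tree rP uP) proj_id //.
  exact: off_parent.
by rewrite -T_order; apply: (recognise_Gamma T_tree dk v0 vd' vp' off_parent off_depth).
Qed.
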